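(* Let $\mathcal{G}$ be a finite connected graph with positive conductances and non-negative killing rates not all zero, with a chosen spanning tree $T$ and chosen orientations $e_1,\dots,e_r$ of the edges not in $T$; let $\mu$ be the loop measure and, for $\alpha>0$, let $\mathcal{L}_\alpha$ be the Poisson point process of loops with intensity $\alpha\mu$. Then, as $(h_1,\dots,h_r)$ varies in $\mathbb{Z}^r$, the integers $|\{l\in\mathcal{L}_\alpha:\ \check N_i(l)=h_i,\ i=1,\dots,r\}|$ are independent Poisson random variables with expectations $$\alpha\,\mu(\{l:\ \check N_i(l)=h_i,\ i=1,\dots,r\})=-\alpha\int_{[0,1]^r}\log\bigl(\det(I-P^{(\theta)})\bigr)\prod_{i=1}^re^{-2\pi\sqrt{-1}\,h_i\theta_i}\,d\theta_i .$$
   Context: Graph and loops: $\mathcal{G}$ is a finite connected non-oriented graph with vertex set $X$ and edge set $E$, with no loop edges and no multiple edges; $r=|E|-|X|+1$. An oriented edge $e$ has extremities $(e^-,e^+)$ and opposite $-e$. A based loop is a path $(x_0,x_1,\dots,x_{n-1},x_0)$, $n\ge1$, along edges; a loop is an equivalence class of based loops under cyclic shift. $\mathrm{mult}(l)$ is the largest integer $m$ such that a based loop representing $l$ is the concatenation of $m$ identical based loops. $N_e(l)$ is the number of times $l$ traverses the oriented edge $e$, and $\check N_i(l)=N_{e_i}(l)-N_{-e_i}(l)$. Markov chain and loop measure: conductances $C_{x,y}=C_{y,x}>0$ on edges ($C_{x,y}=0$ if $\{x,y\}\notin E$), killing rates $\kappa_x\ge0$, not all zero, $\lambda_x=\kappa_x+\sum_yC_{x,y}$,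 $P^x_y=C_{x,y}/\lambda_x$. The loop measure is $\mu(l)=\frac{1}{\mathrm{mult}(l)}\prod_{\text{edges }e\text{ of }l}P^{e^-}_{e^+}$, the product being over all edge traversals of $l$; its total mass is $-\log\det(I-P)<\infty$. Twisted matrix: $\eta^i_{x,y}=1_{\{x=e_i^-,\,y=e_i^+\}}-1_{\{y=e_i^-,\,x=e_i^+\}}$, and for $\theta\in\mathbb{R}^r$, $P^{(\theta)}$ is the $X\times X$ matrix with entries $P^x_y\,e^{2\pi\sqrt{-1}\sum_i\theta_i\eta^i_{x,y}}$. (It is similar to a Hermitian matrix of spectral radius $<1$, so $\det(I-P^{(\theta)})>0$ and the logarithm is real.) *)

(* Defs.v *)
From HB Require Import structures.
From mathcomp Require Import all_boot all_order all_algebra.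
From mathcomp Require Import generic_quotient.
From mathcomp Require Import all_classical all_reals all_analysis measurable_realfun.
From mathcomp Require Import complex.

Set Implicit Arguments.
Unset Strict Implicit.
Unset Printing Implicit Defensive.

Import Order.TTheory GRing.Theory Num.Theory.
Import numFieldNormedType.Exports.

Local Open Scope classical_set_scope.
Local Open Scope ring_scope.

Section graphs.
Variable V : finType.
Implicit Types E T : rel V.

Definition simple_graph E := symmetric E /\ irreflexive E.

Definition connected_graph E := forall x y : V, connect E x y.

(* Unoriented edges are two-element sets of vertices. *)
Definition edges E : {set {set V}} :=
  [set [set p.1; p.2]%SET | p : V * V in [pred p : V * V | E p.1 p.2]]%SET.

(* |E| - |X| + 1; the truncated subtraction is exact for connected graphs. *)
Definition cycle_rank E : nat := (#|edges E|.+1 - #|V|)%N.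

(* In a symmetric relation any edge is traversed back and forth by a [ucycle]
   of size 2, so genuine cycles are those of size at least 3. *)
Definition acyclic_graph T := forall c : seq V, ucycle T c -> (size c < 3)%N.

Definition spanning_tree E T :=
  [/\ simple_graph T, subrel T E, connected_graph T & acyclic_graph T].

Definition chord_orientation E T (eo : 'I_(cycle_rank E) -> V * V) :=
  (forall i, E (eo i).1 (eo i).2 && ~~ T (eo i).1 (eo i).2) /\
  (forall x y, E x y -> ~~ T x y ->
     exists! i, eo i = (x, y) \/ eo i = (y, x)).

End graphs.

Section loops.
Variables (V : finType) (E : rel V).

(* [:: x_0; ...; x_(n-1)] stands for the closed path (x_0, ..., x_(n-1), x_0). *)
Definition is_based_loop (s : seq V) : bool := (s != [::]) && cycle E s.

Definition based_loop : Type := {s : seq V | is_based_loop s}.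

HB.instance Definition _ := SubCountable.on based_loop.

Definition shift_equiv (s t : based_loop) : bool :=
  [exists i : 'I_(size (val s)).+1, val t == rot i (val s)].

Lemma shift_equivP s t :
  reflect (exists i, val t = rot i (val s)) (shift_equiv s t).
Proof.
apply: (iffP existsP) => [[i /eqP st]|[i st]]; first by exists i.
have [lei|lti] := leqP i (size (val s)).
  by exists (inord i); rewrite st inordK.
by exists ord0; rewrite rot0 st rot_oversize// ltnW.
Qed.

Lemma shift_equiv_refl : reflexive shift_equiv.
Proof. by move=> s; apply/shift_equivP; exists 0%N; rewrite rot0. Qed.

Lemma shift_equiv_sym : symmetric shift_equiv.
Proof.
suff imp s t : shift_equiv s t -> shift_equiv t s.
  by move=> s t; apply/idP/idP; apply: imp.
move=> /shift_equivP[i st]; apply/shift_equivP.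
by exists (size (val t) - i)%N; rewrite st -[LHS](rotK i).
Qed.

Lemma shift_equiv_trans : transitive shift_equiv.
Proof.
move=> t s u /shift_equivP[i st] /shift_equivP[j tu].
by apply/shift_equivP; exists (rot_add (val s) i j); rewrite tu st rot_rot_add.
Qed.

Canonical shift_equiv_equiv := EquivRel shift_equiv
  shift_equiv_refl shift_equiv_sym shift_equiv_trans.

Definition loop : Type := {eq_quot shift_equiv}%qT.

HB.instance Definition _ := Countable.on loop.

(* The functionals below are defined on based loops and are invariant under
   cyclic shift; they are evaluated on a representative of the class. *)
Definition rep (l : loop) : seq V := val (repr l).

Definition steps (s : seq V) : seq (V * V) := zip s (rot 1 s).

(* A concatenation of m based loops has length at least m, whence the bound on
   the range of the maximum. *)
Definition mult (l : loop) : nat :=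
  \max_(m < (size (rep l)).+1
       | `[< exists t : based_loop, rep l = flatten (nseq m (val t)) >]) m.

Definition traversals (e : V * V) (l : loop) : nat := count_mem e (steps (rep l)).

Definition net_traversals (e : V * V) (l : loop) : int :=
  (traversals e l)%:Z - (traversals (e.2, e.1) l)%:Z.

End loops.

Section loop_measure.
Variables (R : realType) (V : finType) (E : rel V).
Variables (C : V -> V -> R) (kappa : V -> R).

Definition lambda (x : V) : R := kappa x + \sum_(y : V) C x y.

Definition transition (x y : V) : R := C x y / lambda x.

Definition loop_weight (l : loop E) : R :=
  (mult l)%:R^-1 * \prod_(e <- steps (rep l)) transition e.1 e.2.

Definition loop_measure (A : set (loop E)) : \bar R :=
  (\esum_(l in A) (loop_weight l)%:E)%E.

Local Open Scope complex_scope.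

(* exp (sqrt(-1) t) for real t *)
Definition expi (t : R) : R[i] := cos t +i* sin t.

Variables (r : nat) (eo : 'I_r -> V * V).

Definition eta (i : 'I_r) (x y : V) : R :=
  ((x == (eo i).1) && (y == (eo i).2))%:R -
  ((y == (eo i).1) && (x == (eo i).2))%:R.

Definition twisted_transition (theta : r.-tuple R) : 'M[R[i]]_#|V| :=
  \matrix_(a < #|V|, b < #|V|)
    let x := enum_val a in let y := enum_val b in
    (transition x y)%:C *
    expi (2 * pi * \sum_(i < r) tnth theta i * eta i x y).

End loop_measure.

Section lebesgue_tuple.
Variable R : realType.
Local Notation T := (measurableTypeR R).

Definition tuple_of_pair n (p : T * n.-tuple T) : n.+1.-tuple T :=
  [the n.+1.-tuple T of p.1 :: p.2].

Lemma measurable_tuple_of_pair n :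
  measurable_fun [set: T * n.-tuple T] (@tuple_of_pair n).
Proof. exact: measurable_cons. Qed.

Section step.
Variables (n : nat) (mu : {sigma_finite_measure set (n.-tuple T) -> \bar R}).

Definition lebesgue_tuple_step : set (n.+1.-tuple T) -> \bar R :=
  pushforward (@lebesgue_measure R \x mu)%E (@tuple_of_pair n).

Let mf := @measurable_tuple_of_pair n.

Let step0 : lebesgue_tuple_step set0 = 0%E.
Proof. by rewrite /lebesgue_tuple_step /pushforward preimage_set0 measure0. Qed.

Let step_ge0 A : (0 <= lebesgue_tuple_step A)%E.
Proof. exact: measure_ge0. Qed.

Let step_sigma_additive : semi_sigma_additive lebesgue_tuple_step.
Proof. by apply: measure_semi_sigma_additive; exact: mf. Qed.

HB.instance Definition _ := isMeasure.Build _ _ _ lebesgue_tuple_step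
  step0 step_ge0 step_sigma_additive.

Let step_sigma_finite : sigma_finite setT lebesgue_tuple_step.
Proof.
have /sigma_finiteP[F [FT ndF Foo]] := sigma_finiteT (@lebesgue_measure R).
have /sigma_finiteP[G [GT ndG Goo]] := sigma_finiteT mu.
pose g (t : n.+1.-tuple T) : T * n.-tuple T :=
  (tnth t ord0, [tuple of behead t]).
have mg : measurable_fun setT g.
  by apply/measurable_fun_pair; [exact: measurable_tnth|exact: measurable_behead].
have fgK p : g (tuple_of_pair p) = p.
  by case: p => x t; congr pair; apply/val_inj.
exists (fun k => g @^-1` (F k `*` G k)).
  rewrite predeqE => t; split=> // _.
  have [k _ Fk] : (\bigcup_k F k) (g t).1 by rewrite -FT.
  have [j _ Gj] : (\bigcup_k G k) (g t).2 by rewrite -GT.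
  exists (maxn k j) => //; split.
    by move: Fk; exact/subsetPset/ndF/leq_maxl.
  by move: Gj; exact/subsetPset/ndG/leq_maxr.
move=> k; have [mF Fk] := Foo k; have [mG Gk] := Goo k; split.
  by rewrite -[_ @^-1` _]setTI; apply: mg => //; exact: measurableX.
rewrite /lebesgue_tuple_step /pushforward -comp_preimage.
rewrite (_ : g \o _ = id) ?preimage_id; last exact/funext.
by rewrite product_measure1E// lte_mul_pinfty// ge0_fin_numE.
Qed.

HB.instance Definition _ := Measure_isSigmaFinite.Build _ _ _
  lebesgue_tuple_step step_sigma_finite.

End step.

Fixpoint lebesgue_tuple n : {sigma_finite_measure set (n.-tuple T) -> \bar R} :=
  match n with
  | 0 => \d_([tuple] : 0.-tuple T)
  | n'.+1 => lebesgue_tuple_step (lebesgue_tuple n')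
  end.

Definition unit_cube n : set (n.-tuple T) :=
  [set t | forall i, 0 <= tnth t i <= 1].

End lebesgue_tuple.

Definition Cintegral (R : realType) (d : measure_display) (T : measurableType d)
    (mu : {measure set T -> \bar R}) (D : set T) (f : T -> R[i]) : R[i] :=
  Complex (\int[mu]_(x in D) complex.Re (f x)) (\int[mu]_(x in D) complex.Im (f x)).

Section poisson.
Variables (R : realType) (d : measure_display) (Omega : measurableType d).
Variable P : probability Omega R.
Local Open Scope ereal_scope.

Definition independent (I : eqType) (X : I -> Omega -> \bar R) :=
  forall (s : seq I) (B : I -> set (\bar R)), uniq s ->
    (forall i, measurable (B i)) ->
    P (\bigcap_(i in [set` s]) X i @^-1` B i) = \prod_(i <- s) P (X i @^-1` B i).

(* The library's [poisson_pmf] is not used because its value at rate 0 is not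
   the point mass at 0. The Poisson law with infinite parameter is by convention
   the point mass at infinity. *)
Definition poisson_rv (X : Omega -> \bar R) (m : \bar R) :=
  measurable_fun setT X /\
  match m with
  | m'%:E => (0 <= m')%R /\
      forall k : nat, P [set w | X w = k%:R%:E] = (expR (- m') * m' ^+ k / k`!%:R)%:E
  | +oo => P [set w | X w = +oo] = 1
  | -oo => False
  end.

Variable S : countType.

(* A point process on a countable set is a random multiset, given by the
   multiplicities [L w l] of the points l. *)
Definition point_count (L : Omega -> S -> nat) (A : set S) (w : Omega) : \bar R :=
  \esum_(l in A) (L w l)%:R%:E.

Definition poisson_point_process (L : Omega -> S -> nat) (nu : set S -> \bar R) :=
  (forall A, poisson_rv (point_count L A) (nu A)) /\
  (forall n (A : 'I_n -> set S), trivIset setT A ->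
     independent (fun i => point_count L (A i))).

End poisson.

(* Main.v *)
Require Import Defs.
From HB Require Import structures.
From mathcomp Require Import all_boot all_order all_algebra.
From mathcomp Require Import generic_quotient spectral sesquilinear.
From mathcomp Require Import all_classical all_reals all_analysis measurable_realfun.
From mathcomp Require Import complex.
From mathcomp Require Import ring lra.

(** A loop of length [n] has exactly [n / mult] distinct based representatives,
    so [mu] is the image of the measure giving the based loop [s] of length [n]
    the mass [w(s) / n].  Expanding the trace of [P^(theta)^n] over based loops
    yields [sum_s w(s) e^(2 i pi N(s).theta)]: the Fourier coefficient at [h] of
    [tr (P^(theta)^n) / n] is the mass of the loops of length [n] with [N = h].
    As [P^(theta)] is conjugate to a Hermitian matrix whose eigenvalues have
    modulus less than 1 by the maximum principle,
    [sum_n tr (P^(theta)^n) / n = - ln det (I - P^(theta))], and the partial sums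
    are dominated by [- ln det (I - P)], so that one integrates term by term.
    The distributional part is the definition of a Poisson point process applied
    to the disjoint sets of loops [{N = h}]. *)

Set Implicit Arguments.
Unset Strict Implicit.
Unset Printing Implicit Defensive.

Import Order.TTheory GRing.Theory Num.Theory.
Import numFieldNormedType.Exports.

Local Open Scope classical_set_scope.
Local Open Scope ring_scope.

(** * Rotations of based loops *)

(** Commuting makes [u] a prefix of [v]; once it is removed, the remainder still commutes with [u]
    and is shorter by one copy, so induction on [k] applies. *)
Lemma catC_flatten_nseq (T : eqType) (u v : seq T) k :
  u ++ v = v ++ u -> size v = (k * size u)%N -> v = flatten (nseq k u).
Proof.
elim: k v => [|k IHk] v uv.
  by rewrite mul0n => /size0nil.
rewrite mulSn => sv.
have uE : u = take (size u) v.
  have := take_size_cat v (erefl (size u)).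
  by rewrite uv takel_cat// sv leq_addr.
have vE : v = u ++ drop (size u) v by rewrite {1}uE cat_take_drop.
move: (drop _ _) vE => w vE; subst v.
congr (_ ++ _); apply: IHk.
  by move: uv; rewrite -catA => /eqP; rewrite eqseq_cat// eqxx => /eqP.
by move: sv; rewrite size_cat => /addnI.
Qed.

Lemma flatten_nseq_rcons (T : Type) (u : seq T) k :
  flatten (nseq k u) ++ u = u ++ flatten (nseq k u).
Proof. by elim: k => [|k IHk] /=; rewrite ?cats0// -catA IHk. Qed.

(** The step that closes [u] up is either the closing step of the whole cycle, if there is one copy,
    or the step from the first copy into the second. *)
Lemma cycle_flatten_nseq (T : eqType) (e : rel T) (u : seq T) k :
  cycle e (flatten (nseq k.+1 u)) -> cycle e u.
Proof.
case: u => [//|x u]; case: k => [|k]; first by rewrite /= cats0.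
rewrite /= !rcons_cat /= cat_path /= => /and3P[pu xu _].
by rewrite rcons_path pu.
Qed.

Lemma iter_rot1 (T : Type) (s : seq T) i :
  (i <= size s)%N -> iter i (rot 1) s = rot i s.
Proof.
elim: i => [|i IHi] lei; first by rewrite rot0.
by rewrite iterS IHi ?(ltnW lei)// -rotS.
Qed.

Section finite_orbits.
Variables (T : finType) (f : T -> T) (x : T).
Hypothesis f_inj : injective f.

(** The remainder of [n] modulo the order also fixes [x]; the orbit has no repetition before its
    order, so this remainder is 0. *)
Lemma order_dvdn n : iter n f x = x -> (fingraph.order f x %| n)%N.
Proof.
move=> fn.
have fk k : iter (k * fingraph.order f x) f x = x.
  by elim: k => [//|k IHk]; rewrite mulSn iterD IHk iter_order.
have := divn_eq n (fingraph.order f x).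
set q := (n %/ _)%N; set m := (n %% _)%N => nE.
have ltm : (m < fingraph.order f x)%N by rewrite ltn_mod order_gt0.
have fm : iter m f x = x.
  by rewrite -[RHS]fn nE addnC iterD fk.
have := orbit_uniq f x; rewrite /orbit => /(uniqP x)/(_ m 0%N).
rewrite !inE size_traject ltm order_gt0 => /(_ isT isT).
by rewrite !nth_traject ?order_gt0//= fm => /(_ erefl) m0; apply/eqP.
Qed.

End finite_orbits.

Section rotations.
Variables (V : finType) (E : rel V).

Lemma size_rep_gt0 (l : loop E) : (0 < size (rep l))%N.
Proof. by rewrite /rep; case: (repr l) => -[//|x s] /= /andP[]. Qed.

Lemma cycle_rep (l : loop E) : cycle E (rep l).
Proof. by rewrite /rep; case: (repr l) => s /= /andP[]. Qed.

(** Orbit counting: the distinct based representatives form the orbit of [rep l] under rotation by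
    one step. If this orbit has [p] elements, [rep l] is a power of its prefix of length [p], and
    [mult l] is the exponent [n %/ p]. *)
Lemma exists_rotations_rep (l : loop E) : exists ss : seq (seq V),
  [/\ uniq ss, forall s, s \in ss <-> exists i, s = rot i (rep l) &
      (size ss * mult l)%N = size (rep l)].
Proof.
set s := rep l; set n := size s.
(* Rotation is taken on [n]-tuples, a finite type, so that orbits and orders of an injective map are
   available. *)
pose f (t : n.-tuple V) : n.-tuple V := [tuple of rot 1 t].
have f_inj : injective f by move=> t u [] /rot_inj tu; exact/val_inj.
pose t0 : n.-tuple V := in_tuple s.
have val_iter i : val (iter i f t0) = iter i (rot 1) s.
  by elim: i => //= i ->.
pose p := fingraph.order f t0.
have p_gt0 : (0 < p)%N by exact: order_gt0.
have n_gt0 : (0 < n)%N by exact: size_rep_gt0.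
have iter_n : iter n f t0 = t0.
  by apply/val_inj; rewrite val_iter iter_rot1// rot_size.
have pn : (p %| n)%N by exact: order_dvdn.
have lepn : (p <= n)%N by exact: dvdn_leq.
exists (map val (orbit f t0)); split.
- by rewrite map_inj_uniq ?orbit_uniq//; exact: val_inj.
- move=> u; split.
    move=> /mapP[t]; rewrite -fconnect_orbit => t0t ->.
    exists (findex f t0 t); rewrite -{1}(iter_findex t0t) val_iter iter_rot1//.
    by rewrite (leq_trans (ltnW (findex_max t0t))).
  move=> [i ->].
  wlog lein : i / (i <= n)%N => [wl|].
    have [/wl//|/ltnW ni] := leqP i n.
    by rewrite rot_oversize//; have := wl 0%N (leq0n _); rewrite rot0.
  rewrite -iter_rot1// -val_iter map_f// -fconnect_orbit.
  exact: fconnect_iter.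
rewrite size_map size_orbit -/p.
(* Invariance under rotation by [p] says that the prefix of length [p] and the remaining suffix
   commute. *)
have sE : s = flatten (nseq (n %/ p) (take p s)).
  have rotp : rot p s = s.
    by rewrite -iter_rot1// -val_iter iter_order.
  apply: (@catC_flatten_nseq _ (take p s)); last first.
    by rewrite size_takel// divnK.
  by rewrite -{2}rotp /rot catA cat_take_drop.
suff -> : mult l = (n %/ p)%N by rewrite mulnC divnK.
(* Upper bound: if [s] is [m] copies of [t], rotation by the length of [t] fixes [s], so [p] divides
   that length. Lower bound: the power found in [sE] is admissible in the maximum. *)
apply/eqP; rewrite eqn_leq; apply/andP; split.
  apply/bigmax_leqP => -[m ltm] /= /asboolP[t lE]; rewrite -/s in lE.
  rewrite leq_divRL// mulnC.
  have [m0|m_gt0] := posnP m.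
    by rewrite m0 muln0.
  have sm : n = (m * size (val t))%N.
    rewrite /n lE size_flatten /shape map_nseq sumn_nseq//.
    by rewrite mulnC.
  rewrite sm mulnC leq_mul2l; apply/orP; right.
  have t_gt0 : (0 < size (val t))%N.
    by move: n_gt0; rewrite sm muln_gt0 => /andP[].
  apply: dvdn_leq => //; apply: order_dvdn => //.
  apply/val_inj; rewrite val_iter iter_rot1; last by rewrite -/n sm leq_pmull.
  rewrite [RHS](_ : _ = s)// lE -(prednK m_gt0) /= rot_size_cat.
  exact: flatten_nseq_rcons.
have nps : (n %/ p < n.+1)%N by rewrite ltnS leq_div.
have np_gt0 : (0 < n %/ p)%N by rewrite divn_gt0.
rewrite /mult -/s -/n.
apply: (@leq_bigmax_cond _ _ (fun m : 'I_n.+1 => val m) (Ordinal nps)) => /=.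
apply/asboolP.
have bl : is_based_loop E (take p s).
  apply/andP; split; first by rewrite -size_eq0 size_takel// -lt0n.
  apply: (@cycle_flatten_nseq _ _ _ (n %/ p).-1).
  by rewrite prednK// -sE; exact: cycle_rep.
by exists (Sub _ bl).
Qed.
End rotations.

(** * Loops, walks and traces *)

Lemma big_tuple_cons (A : nmodType) (V : finType) n (F : n.+1.-tuple V -> A) :
  \sum_(t : n.+1.-tuple V) F t =
  \sum_(x : V) \sum_(t : n.-tuple V) F [tuple of x :: t].
Proof.
rewrite pair_bigA /=.
rewrite (reindex (fun p : V * n.-tuple V => [tuple of p.1 :: p.2])) //=.
exists (fun t => (thead t, [tuple of behead t])) => [[x t] _|t _] /=.
  by congr pair; apply/val_inj.
by rewrite -tuple_eta.
Qed.

Section traces.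
Variables (A : comNzRingType) (V : finType) (K : V -> V -> A).

Let M : 'M[A]_#|V| := \matrix_(a, b) K (enum_val a) (enum_val b).

(** The tuple [t] lists the interior vertices of a walk of [n.+1] steps; the induction splits off
    the first step. *)
Lemma mx_pow_walks n a b : (M ^+ n.+1) a b =
  \sum_(t : n.-tuple V)
    \prod_(e <- zip (enum_val a :: t) (rcons t (enum_val b))) K e.1 e.2.
Proof.
elim: n a => [|n IHn] a.
  rewrite expr1 mxE (big_pred1 [tuple]) /=.
    by rewrite big_seq1.
  by move=> t; rewrite [t]tuple0; apply/esym/eqP.
rewrite exprS mxE big_tuple_cons (reindex (@enum_val V V)) /=; last first.
  by exists enum_rank => x _; rewrite ?enum_valK ?enum_rankK.
rewrite [RHS](eq_bigl predT)//; apply: eq_bigr => c _.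
rewrite mxE IHn big_distrr /=; apply: eq_bigr => t _.
by rewrite big_cons.
Qed.

(** On the diagonal the walks close up and their steps become [steps t]. All vertex tuples occur
    here, adjacent or not; the kernel is what gives weight 0 to those leaving the graph. *)
Lemma mxtrace_pow_loops n :
  \tr (M ^+ n.+1) = \sum_(t : n.+1.-tuple V) \prod_(e <- steps t) K e.1 e.2.
Proof.
rewrite big_tuple_cons /mxtrace (reindex (@enum_val V V)) /=; last first.
  by exists enum_rank => x _; rewrite ?enum_valK ?enum_rankK.
rewrite [RHS](eq_bigl predT)//; apply: eq_bigr => c _.
rewrite mx_pow_walks; apply: eq_bigr => t _.
by rewrite /steps rot1_cons.
Qed.

End traces.

Lemma zip_rot (S T : Type) i (s : seq S) (t : seq T) :
  size s = size t -> zip (rot i s) (rot i t) = rot i (zip s t).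
Proof.
move=> st; have [les|lti] := leqP (size s) i.
  by rewrite !rot_oversize ?size_zip -?st ?minnn.
have stk : size (take i s) = size (take i t) by rewrite !size_take st.
rewrite /rot zip_cat; last by rewrite !size_drop st.
rewrite -[in RHS](cat_take_drop i s) -[in RHS](cat_take_drop i t) zip_cat//.
have si : size (zip (take i s) (take i t)) = i.
  by rewrite size_zip -stk minnn size_takel// ltnW.
by rewrite drop_size_cat// take_size_cat.
Qed.

Lemma steps_rot (V : finType) (s : seq V) i : steps (rot i s) = rot i (steps s).
Proof. by rewrite /steps rot_rot zip_rot// size_rot. Qed.

Lemma loop_eq (V : finType) (E : rel V) (l l' : loop E) :
  shift_equiv (repr l) (repr l') -> l = l'.
Proof. by move=> ll'; rewrite -(reprK l) -(reprK l'); apply/eqmodP. Qed.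

Section loop_sums.
Variables (R : realType) (V : finType) (E : rel V).
Variables (C : V -> V -> R) (kappa : V -> R).
Hypothesis C_ge0 : forall x y, 0 <= C x y.
Hypothesis C_eq0 : forall x y, ~~ E x y -> C x y = 0.
Hypothesis kappa_ge0 : forall x, 0 <= kappa x.

Definition walk_weight (s : seq V) : R :=
  \prod_(e <- steps s) transition C kappa e.1 e.2.

Lemma transition_ge0 x y : 0 <= transition C kappa x y.
Proof. by rewrite divr_ge0// addr_ge0// sumr_ge0. Qed.

Lemma walk_weight_ge0 s : 0 <= walk_weight s.
Proof. by apply: prodr_ge0 => e _; exact: transition_ge0. Qed.

Lemma walk_weight_rot i s : walk_weight (rot i s) = walk_weight s.
Proof.
by rewrite /walk_weight steps_rot; apply/perm_big; rewrite perm_rot.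
Qed.

Lemma walk_weight_cycle s : walk_weight s != 0 -> cycle E s.
Proof.
case: s => [//|x s]; rewrite /walk_weight /steps rot1_cons /=.
(* Only the starting vertex is generalized; the vertex at which the path closes stays fixed. *)
elim: s {1 3}x => [|z s IHs] y /=.
  rewrite big_seq1 andbT; apply: contra_neqT => /= yx.
  by rewrite /transition C_eq0// mul0r.
rewrite big_cons /= mulf_eq0 negb_or => /andP[Pyz /IHs ->]; rewrite andbT.
by apply: contra_neqT Pyz => /= yx; rewrite /transition C_eq0// mul0r.
Qed.

(** Since [1 / mult] equals the number of rotations divided by the length, the mass of a loop
    spreads evenly over its based representatives, all of the same weight and length. *)
Lemma loop_weight_rotations (l : loop E) :
  ((loop_weight C kappa l)%:E =
   \esum_(s in [set s | exists i, s = rot i (rep l)])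
     (walk_weight s / (size s)%:R)%:E)%E.
Proof.
have [ss [ss_uniq ssP ssize]] := exists_rotations_rep l.
rewrite esum_fset; last 2 first.
- have -> : [set s | exists i, s = rot i (rep l)] = [set` ss].
    by apply/seteqP; split => s /ssP.
  exact: finite_seq.
- by move=> s _; rewrite lee_fin divr_ge0// walk_weight_ge0.
have -> : [set s | exists i, s = rot i (rep l)] = [set` ss].
  by apply/seteqP; split => s /ssP.
rewrite -fsbig_seq// (eq_big_seq (fun=> (walk_weight (rep l) / (size (rep l))%:R)%:E)).
  rewrite sumEFin; congr EFin.
  rewrite big_const_seq count_predT iter_addr_0 /loop_weight -/(walk_weight _) -ssize natrM.
  have : (0 < size ss * mult l)%N by rewrite ssize size_rep_gt0.
  rewrite muln_gt0 => /andP[ss0 m0].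
  rewrite -mulr_natl; field.
  by rewrite !pnatr_eq0 -!lt0n ss0 m0.
by move=> s /ssP[i ->]; rewrite walk_weight_rot size_rot.
Qed.

(** The rotation classes partition the based loops, so the sum over loops becomes a sum over based
    loops, which is then sorted by length. Rotation invariance of [Q] makes the condition on [rep l]
    one on every representative. *)
Lemma loop_measure_walks (Q : pred (seq V)) :
  (forall i s, Q (rot i s) = Q s) ->
  loop_measure C kappa [set l : loop E | Q (rep l)] =
  (\sum_(0 <= n <oo)
    (n.+1%:R^-1 * \sum_(t : n.+1.-tuple V | Q t) walk_weight t)%:E)%E.
Proof.
move=> Q_rot; rewrite /loop_measure.
pose F (s : seq V) : \bar R := (walk_weight s / (size s)%:R)%:E.
have F_ge0 s : (0 <= F s)%E by rewrite lee_fin divr_ge0// walk_weight_ge0.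
pose A := [set l : loop E | Q (rep l)].
pose J (l : loop E) := [set s | exists i, s = rot i (rep l)].
pose S := [set s | [/\ s != [::], cycle E s & Q s]].
rewrite (eq_esum (b := fun l => (\esum_(s in J l) F s)%E)); last first.
  by move=> l _; exact: loop_weight_rotations.
rewrite (@esum_esum _ _ _ _ _ (fun _ => F))// -/A.
transitivity (\esum_(s in S) F s)%E.
  (* The second projection is a bijection from pairs of a loop and one of its rotations onto [S]: a
     closed path determines its class. *)
  symmetry; apply: (reindex_esum _ _ snd); split.
  - move=> [l s] /= [Al [i ->]]; split.
    + by rewrite -size_eq0 size_rot -lt0n size_rep_gt0.
    + by rewrite rot_cycle cycle_rep.
    + by rewrite Q_rot.
  - move=> [l s] [l' s']; rewrite !inE /= => -[_ [i sE]] [_ [j s'E]] ss'.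
    subst s'; congr pair; last by [].
    apply: loop_eq.
    have bs : is_based_loop E s.
      apply/andP; split.
        by rewrite sE -size_eq0 size_rot -lt0n size_rep_gt0.
      by rewrite sE rot_cycle cycle_rep.
    apply: (@shift_equiv_trans _ _ (Sub s bs)).
      by apply/shift_equivP; exists i.
    by rewrite shift_equiv_sym; apply/shift_equivP; exists j.
  - move=> s [s0 cs Qs].
    have bs : is_based_loop E s by rewrite /is_based_loop s0.
    pose l : loop E := (\pi_(loop E) (Sub s bs : based_loop E))%qT.
    have : shift_equiv (repr l) (Sub s bs) by apply/eqmodP; rewrite reprK.
    move=> /shift_equivP[i /= sE].
    exists (l, s) => //; split; last by exists i.
    by rewrite /A /= -(Q_rot i) -sE.
pose T n := [set t : n.+1.-tuple V | cycle E t && Q t].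
have -> : S = \bigcup_n (val @` T n).
  apply/seteqP; split => [s [s0 cs Qs]|s [n _ [t /andP[ct Qt] <-]]].
    exists (size s).-1 => //.
    have sE : size s == (size s).-1.+1.
      by rewrite prednK// lt0n size_eq0.
    by exists (Tuple sE) => //; rewrite /T /= cs.
  by split=> //; rewrite -size_eq0 size_tuple.
rewrite nneseries_sum_bigcup//; last first.
  move=> m n _ _ [s [[t _ <-] [u _ /(congr1 size)]]].
  by rewrite !size_tuple => -[].
apply: eq_eseriesr => n _.
rewrite esum_image; last by move=> t u _ _; exact: val_inj.
have -> : T n = 
    [set` [seq t : n.+1.-tuple V <- enum {: n.+1.-tuple V} | cycle E t && Q t]].
  by apply/seteqP; split => t; rewrite /= mem_filter mem_enum andbT.
rewrite esum_fset//.
rewrite -fsbig_seq; last exact: filter_uniq (enum_uniq _).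
rewrite big_filter big_enum_cond /=.
rewrite sumEFin; congr EFin.
rewrite big_distrr /= big_mkcond [RHS]big_mkcond /=; apply: eq_bigr => t _.
have [Qt|] := boolP (Q t); rewrite ?andbF// andbT.
case: ifPn => [_|ct]; first by rewrite size_tuple mulrC.
(* A tuple that is not a closed path of the graph has weight 0, so it may be included in the sum. *)
apply/esym/eqP; rewrite mulf_eq0; apply/orP; right; apply: contraNT ct.
exact: walk_weight_cycle.
Qed.

End loop_sums.

(** * Spectrum of the twisted transition matrix *)

Section similar_to_diagonal.
Variables (F : fieldType) (n : nat) (M W : 'M[F]_n) (d : 'rV[F]_n).
Hypothesis W_unit : W \in unitmx.
Hypothesis WM : W *m M = diag_mx d *m W.

Let ME : M = invmx W *m diag_mx d *m W.
Proof. by rewrite -mulmxA -WM mulKmx. Qed.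

Lemma det_sub_similar_diag : \det (1%:M - M) = \prod_i (1 - d 0 i).
Proof.
have -> : 1%:M - M = invmx W *m (1%:M - diag_mx d) *m W.
  by rewrite mulmxBr mulmxBl mulmx1 mulVmx// -ME.
rewrite !det_mulmx mulrAC -det_mulmx mulVmx// det1 mul1r.
rewrite (_ : 1%:M - diag_mx d = diag_mx (\row_i (1 - d 0 i))).
  by rewrite det_diag; apply: eq_bigr => i _; rewrite mxE.
apply/matrixP => i j; rewrite !mxE.
by case: eqVneq => [->|_]; rewrite ?mulr1n// ?mulr0n subr0.
Qed.

Lemma trace_pow_similar_diag k : \tr (M ^+ k) = \sum_i d 0 i ^+ k.
Proof.
have -> : M ^+ k = invmx W *m diag_mx (\row_i (d 0 i ^+ k)) *m W.
  elim: k => [|k IHk].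
    rewrite expr0 (_ : diag_mx _ = 1%:M) ?mulmx1 ?mulVmx//.
    by apply/matrixP => i j; rewrite !mxE expr0.
  rewrite exprS IHk -[LHS]/(_ *m _) {1}ME !mulmxA mulmxK//; congr (_ *m _).
  rewrite -mulmxA; congr (_ *m _).
  apply/matrixP => i j; rewrite mul_diag_mx !mxE exprS.
  by rewrite mulrnAr.
rewrite -mulmxA mxtrace_mulC -mulmxA mulmxV// mulmx1 mxtrace_diag.
by apply: eq_bigr => i _; rewrite mxE.
Qed.

Lemma row_similar_diag i : row i W *m M = d 0 i *: row i W.
Proof.
by rewrite -row_mul WM; apply/rowP => j; rewrite mul_diag_mx !mxE.
Qed.

Lemma row_unitmx_neq0 i : row i W != 0.
Proof.
apply/eqP => Wi0; have := congr1 (row i) (mulmxV W_unit).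
rewrite row_mul Wi0 mul0mx => /rowP/(_ i); rewrite !mxE eqxx => /esym/eqP.
by rewrite oner_eq0.
Qed.

End similar_to_diagonal.

Section conductances.
Variables (R : realType) (V : finType) (E : rel V).
Variables (C : V -> V -> R) (kappa : V -> R).
Hypothesis connE : connected_graph E.
Hypothesis C_sym : forall x y, C x y = C y x.
Hypothesis C_gt0 : forall x y, E x y -> 0 < C x y.
Hypothesis C_ge0 : forall x y, 0 <= C x y.
Hypothesis kappa_ge0 : forall x, 0 <= kappa x.
Hypothesis kappa_neq0 : exists x, kappa x != 0.

(** Along a path to a vertex [z] with killing, either the path is empty and the killing at [x] is
    positive, or its first edge has positive conductance. *)
Lemma lambda_gt0 x : 0 < lambda C kappa x.
Proof.
have [z kz] := kappa_neq0.
have /connectP[[|y p] /=] := connE x z.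
  by move=> _ <-; rewrite ltr_wpDr ?sumr_ge0// lt0r kz kappa_ge0.
move=> /andP[/C_gt0 xy _] _; rewrite ltr_wpDl// (bigD1 y)//= ltr_pwDl//.
exact: sumr_ge0.
Qed.

(* Maximum principle: at a maximum of [a] the inequality forces the killing to
   vanish and the neighbours to be maxima too. *)
Lemma subeigen_lt1 (a : V -> R) (c : R) :
  (forall x, 0 <= a x) -> (exists x, a x != 0) ->
  (forall y, c * (lambda C kappa y * a y) <= \sum_x C x y * a x) -> c < 1.
Proof.
move=> a_ge0 [x0 ax0] ha; rewrite ltNge; apply/negP => c1.
have [m _ hm] := @Order.TotalTheory.arg_maxP _ R V x0 xpredT a isT.
have am_gt0 : 0 < a m.
  by apply: lt_le_trans (hm x0 isT); rewrite lt0r ax0 a_ge0.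
have step y : a y = a m -> kappa y = 0 /\ forall x, E y x -> a x = a m.
  move=> aym.
  have := ha y; rewrite aym => hy.
  have : kappa y * a m + \sum_x C y x * (a m - a x) <= 0.
    have l_ge0 : 0 <= lambda C kappa y * a m by rewrite mulr_ge0// ltW// lambda_gt0.
    have : lambda C kappa y * a m <= \sum_x C x y * a x.
      by apply: le_trans hy; rewrite ler_peMl.
    rewrite /lambda mulrDl big_distrl /= => h.
    under eq_bigr do rewrite mulrBr; rewrite sumrB.
    by under [X in _ + (_ - X)]eq_bigr do rewrite C_sym; lra.
  have k0 : 0 <= kappa y * a m by rewrite mulr_ge0.
  have s0 x : true -> 0 <= C y x * (a m - a x).
    by move=> _; rewrite mulr_ge0// subr_ge0; exact: hm.
  have S0 : 0 <= \sum_x C y x * (a m - a x) by exact: sumr_ge0.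
  move=> hle; split.
    have /eqP : kappa y * a m = 0 by lra.
    by rewrite mulf_eq0 (gt_eqF am_gt0) orbF => /eqP.
  move=> x /C_gt0 yx.
  have /(psumr_eq0P s0)/(_ x isT)/eqP : \sum_x C y x * (a m - a x) = 0 by lra.
  by rewrite mulf_eq0 gt_eqF//= subr_eq0 => /eqP ->.
(* Connectedness carries the maximum to every vertex, in particular to one with nonzero killing,
   which contradicts [step]. *)
have all_m x : a x = a m.
  have /connectP[p] := connE m x.
  elim/last_ind: p x => [x _ ->//|p z IHp x].
  rewrite rcons_path last_rcons => /andP[pm] ez ->.
  by have [_] := step _ (IHp _ pm erefl); exact.
have [z] := kappa_neq0; have [-> _] := step z (all_m z).
by rewrite eqxx.
Qed.

Local Open Scope complex_scope.

Lemma expiD (s t : R) : expi (s + t) = expi s * expi t.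
Proof.
rewrite /expi cosD sinD; simpc.
by congr (_ +i* _); rewrite addrC.
Qed.

Lemma expi0 : expi (0 : R) = 1.
Proof. by rewrite /expi cos0 sin0. Qed.

Lemma conjc_expi (t : R) : (expi t)^* = expi (- t).
Proof. by rewrite /expi cosN sinN. Qed.

Lemma norm_expi (t : R) : `|expi t| = 1.
Proof. by rewrite normc_def /= cos2Dsin2 sqrtr1. Qed.

Variable phi : V -> V -> R.
Hypothesis phi_anti : forall x y, phi y x = - phi x y.

Let M : 'M[R[i]]_#|V| := \matrix_(a, b)
  ((transition C kappa (enum_val a) (enum_val b))%:C *
   expi (phi (enum_val a) (enum_val b))).

(** Taking moduli in the eigenvector equation removes the phases, and the triangle inequality leaves
    the inequality to which the maximum principle applies. *)
Lemma twisted_eigenvalue_lt1 (v : 'rV[R[i]]_#|V|) (c : R) :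
  v != 0 -> v *m M = c%:C *: v -> `|c| < 1.
Proof.
move=> v0 vM.
pose normc (z : R[i]) := Num.sqrt (complex.Re z ^+ 2 + complex.Im z ^+ 2).
have normE (z : R[i]) : `|z| = (normc z)%:C by rewrite normc_def.
(* Dividing by [lambda] turns the transition probabilities acting on a row vector into the symmetric
   conductances. *)
pose a x : R := normc (v 0 (enum_rank x)) / lambda C kappa x.
have l0 := lambda_gt0.
apply: (@subeigen_lt1 a).
- by move=> x; rewrite divr_ge0 ?(ltW (l0 _)) ?sqrtr_ge0.
- have /existsP[i vi] : [exists i, v 0 i != 0].
    apply: contraNT v0 => /existsPn h; apply/eqP/rowP => i; rewrite mxE.
    by apply/eqP; have := h i; rewrite negbK.
  exists (enum_val i); rewrite /a enum_valK mulf_eq0 invr_eq0 (gt_eqF (l0 _)) orbF.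
  by apply: contra_neq vi => n0; apply/normr0_eq0; rewrite normE n0.
move=> y; rewrite /a.
have /(congr1 (fun w : 'rV_#|V| => w 0 (enum_rank y))) := vM.
rewrite !mxE => /(congr1 Num.norm); rewrite normrM => h.
rewrite [lambda C kappa y * _]mulrC divfK ?gt_eqF// -lecR rmorphM /= -normE.
have -> : `|c|%:C = `|c%:C| by rewrite normc_def /= expr0n addr0 sqrtr_sqr.
rewrite -h; apply: le_trans (ler_norm_sum _ _ _) _.
rewrite rmorph_sum /= (reindex (@enum_rank V)) /=; last first.
  by exists enum_val => x _; rewrite ?enum_valK ?enum_rankK.
rewrite le_eqVlt; apply/orP; left; apply/eqP.
rewrite [RHS](eq_bigl predT)//; apply: eq_bigr => x _.
rewrite mxE !enum_rankK !normrM norm_expi mulr1 normE.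
rewrite (@ger0_norm _ (transition C kappa x y)%:C); last first.
  by rewrite ler0c divr_ge0// ltW.
by rewrite -rmorphM /=; congr (_%:C); rewrite /transition; ring.
Qed.

(** Conjugation by the diagonal matrix of the square roots of [lambda] gives entries [C x y * expi
    (phi x y) / sqrt (lambda x * lambda y)]. This matrix is Hermitian because [C] is symmetric and
    [phi] antisymmetric, so the spectral theorem provides real eigenvalues. *)
Lemma twisted_spectrum : exists d : 'I_#|V| -> R,
  [/\ forall i, `|d i| < 1,
      \det (1%:M - M) = (\prod_i (1 - d i))%:C &
      forall n, \tr (M ^+ n) = (\sum_i d i ^+ n)%:C].
Proof.
have l0 := lambda_gt0.
pose q : 'rV[R[i]]_#|V| := \row_a (Num.sqrt (lambda C kappa (enum_val a)))%:C.
pose D := diag_mx q.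
pose Dinv := diag_mx (\row_a (q 0 a)^-1).
have q0 a : q 0 a != 0.
  by rewrite mxE (inj_eq (@complexI R)) gt_eqF// sqrtr_gt0.
have DDinv : D *m Dinv = 1%:M.
  apply/matrixP => i j; rewrite mul_diag_mx !mxE.
  case: eqVneq => [->|]; rewrite ?mulr0n ?mulr0// mulr1n mulfV//.
  by have := q0 j; rewrite mxE.
have [D_unit _] := mulmx1_unit DDinv.
have DinvE : invmx D = Dinv.
  by rewrite -[LHS]mulmx1 -DDinv mulmxA mulVmx// mul1mx.
pose H := D *m M *m Dinv.
have HE a b : H a b =
    (C (enum_val a) (enum_val b))%:C * expi (phi (enum_val a) (enum_val b)) /
    (q 0 a * q 0 b).
  rewrite /H mul_mx_diag mxE mul_diag_mx mxE !mxE /transition.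
  set l := lambda C kappa (enum_val a); set sb := Num.sqrt (lambda _ _ _).
  have sa0 : (Num.sqrt l)%:C != 0 by have := q0 a; rewrite mxE.
  have sb0 : sb%:C != 0 by have := q0 b; rewrite mxE.
  have -> : (C (enum_val a) (enum_val b) / l)%:C =
      (C (enum_val a) (enum_val b))%:C / ((Num.sqrt l)%:C * (Num.sqrt l)%:C).
    by rewrite -rmorphM /= -expr2 sqr_sqrtr ?(ltW (l0 _))// -fmorphV -rmorphM.
  by field; rewrite sa0 sb0.
have H_herm : H \is hermsymmx.
  apply/is_hermitianmxP; rewrite expr0 scale1r; apply/matrixP => a b.
  rewrite [RHS]mxE [X in Num.conj X]mxE !HE phi_anti C_sym.
  rewrite -[RHS]/((_)^*)%C.
  have conjM (u v : R[i]) : (u * v)^*%C = u^*%C * v^*%C by exact: rmorphM.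
  rewrite !conjM conjc_real conjc_expi conjc_inv conjM !mxE !conjc_real.
  by rewrite [X in _ = _ / X]mulrC.
have /orthomx_spectralP HS := hermitian_normalmx H_herm.
have /mxOverP d_real := hermitian_spectral_diag_real H_herm.
pose dc := spectral_diag H; pose U := spectralmx H.
have U_unit : U \in unitmx := spectral_unit H.
(* Composing the unitary diagonalization of [H] with [D] diagonalizes [M] itself; the rows of [W]
   are left eigenvectors of [M]. *)
pose W := U *m D.
have W_unit : W \in unitmx by rewrite unitmx_mul U_unit.
have WM : W *m M = diag_mx dc *m W.
  have HD : H *m D = D *m M by rewrite /H -DinvE mulmxKV.
  have UH : U *m H = diag_mx dc *m U by rewrite {1}HS -mulmxA mulKVmx.
  by rewrite /W -mulmxA -HD (mulmxA U H D) UH mulmxA.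
pose d i := complex.Re (dc 0 i).
have dE i : dc 0 i = (d i)%:C by rewrite RRe_real.
exists d; split.
- move=> i; apply: (@twisted_eigenvalue_lt1 (row i W)).
    exact: row_unitmx_neq0.
  by rewrite (row_similar_diag WM) dE.
- rewrite (det_sub_similar_diag W_unit WM) rmorph_prod /=; apply: eq_bigr => i _.
  by rewrite rmorphB rmorph1 dE.
- move=> n; rewrite (trace_pow_similar_diag W_unit WM) rmorph_sum /=.
  by apply: eq_bigr => i _; rewrite rmorphXn dE.
Qed.

End conductances.

(** * Logarithmic series *)

(** The remainder [g n] vanishes at 0 and has derivative [t ^+ n / (1 - t)], so the mean value
    theorem bounds it at [x] by a geometric term tending to 0. *)
Lemma cvg_ln_series (R : realType) (x : R) : `|x| < 1 ->
  (\sum_(k < n) x ^+ k.+1 / k.+1%:R) @[n --> \oo] --> - ln (1 - x).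
Proof.
move=> x1.
pose g n (t : R) : R := - ln (1 - t) - \sum_(k < n) t ^+ k.+1 / k.+1%:R.
have dg n (t : R) : t < 1 -> is_derive t 1 (g n) (t ^+ n / (1 - t)).
  move=> t1; have t1' : 0 < 1 - t by rewrite subr_gt0.
  elim: n => [|n IHn].
    rewrite expr0 mul1r.
    have dln : is_derive (1 - t) 1 (@ln R) (1 - t)^-1 by exact: is_derive1_ln.
    rewrite (_ : g 0%N = - (@ln R \o (fun t => 1 - t))); last first.
      by apply/funext => u; rewrite /g big_ord0 subr0.
    apply: is_derive_eq.
    by rewrite /GRing.scale /=; field; rewrite gt_eqF.
  rewrite (_ : g n.+1 = g n - (n.+1%:R^-1 \*: (fun u : R => u ^+ n.+1))); last first.
    apply/funext => u; rewrite /g big_ord_recr/= opprD addrA.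
    by rewrite [in LHS](mulrC (u ^+ n.+1)).
  have dX : is_derive t 1 (fun u : R => u ^+ n.+1) (n.+1%:R * t ^+ n).
    apply: DeriveDef; first exact: exprn_derivable.
    by rewrite exp_derive /GRing.scale /= mulr1.
  apply: (is_derive_eq (is_deriveB IHn (is_deriveZ n.+1%:R^-1 dX))).
  rewrite /GRing.scale /= mulrA mulVf ?pnatr_eq0// exprS; field.
  by rewrite gt_eqF.
have g0 n : g n 0 = 0.
  rewrite /g subr0 ln1 oppr0 sub0r big1 ?oppr0// => k _.
  by rewrite expr0n /= mul0r.
have gle n : `|g n x| <= `|x| ^+ n.+1 / (1 - `|x|).
  have bound c : `|c| <= `|x| ->
      `|c ^+ n / (1 - c) * x| <= `|x| ^+ n.+1 / (1 - `|x|).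
    move=> cx; rewrite !normrM normfV normrX exprSr.
    have c1 : 0 < 1 - c.
      by rewrite subr_gt0; apply: le_lt_trans x1; apply: le_trans cx; exact: ler_norm.
    rewrite [leRHS]mulrAC; apply: ler_wpM2r => //.
    apply: ler_pM => //.
      by rewrite lerXn2r// nnegrE.
    rewrite gtr0_norm// lef_pV2 ?posrE//; last by rewrite subr_gt0.
    rewrite lerD2l lerN2.
    by apply: le_trans cx; exact: ler_norm.
  have lt1 c (a b : R) : a <= b -> b < 1 -> c \in `[a, b] -> c < 1.
    by move=> _ b1; rewrite in_itv/= => /andP[_ cb]; exact: le_lt_trans cb b1.
  have mvt a b : a <= b -> b < 1 ->
      exists2 c, c \in `[a, b] & g n b - g n a = c ^+ n / (1 - c) * (b - a).
    move=> ab b1; apply: (@MVT_segment R (g n) (fun t => t ^+ n / (1 - t))) => //.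
      by move=> c /subset_itv_oo_cc cab; apply: dg; exact: lt1 cab.
    apply: derivable_within_continuous => c cab.
    by have [] := dg n c (lt1 _ _ _ ab b1 cab).
  (* The mean value theorem is applied on the segment between 0 and [x], whose order depends on the
     sign of [x]. *)
  have [x0|/ltW x0] := leP 0 x.
    have [|c] := mvt 0 x x0; first by rewrite -(ger0_norm x0).
    rewrite in_itv /= => /andP[c0 cx]; rewrite g0 !subr0 => ->.
    by apply: bound; rewrite !ger0_norm.
  have [|c] := mvt x 0 x0; first by [].
  rewrite in_itv /= => /andP[xc c0]; rewrite g0 !sub0r mulrN => /oppr_inj ->.
  by apply: bound; rewrite !ler0_norm// lerN2.
have cvg0 : `|x| ^+ n.+1 / (1 - `|x|) @[n --> \oo] --> 0.
  rewrite -[X in _ --> X](mul0r (1 - `|x|)^-1).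
  apply: cvgMl; rewrite (cvg_shiftS (fun n => `|x| ^+ n)).
  by apply: cvg_expr; rewrite normr_id.
apply/cvgrPdist_le => e e0.
move/cvgrPdist_le : cvg0 => /(_ e e0); apply: filterS => n.
rewrite sub0r normrN; apply: le_trans; apply: le_trans (gle n) _.
exact: ler_norm.
Qed.

(** * Fourier orthogonality on the unit cube *)

Lemma sinD2piz (R : realType) (a : R) (k : int) :
  sin (a + 2 * pi * k%:~R) = sin a.
Proof.
have h n b : sin (b + 2 * pi * n%:R) = sin b :> R.
  by rewrite mulr_natr mulr_natl (periodicn (@sinD2pi R)).
case: k => n; first exact: h.
by rewrite NegzE mulrNz -[in RHS](subrK (2 * pi * n.+1%:R) a) h mulrN.
Qed.

Lemma continuous_cos_affine (R : realType) (a w : R) :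
  continuous (fun t : R => cos (a + w * t)).
Proof.
move=> t; apply: (@continuous_comp _ _ _ (fun t => a + w * t) (@cos R)).
  apply: cvgD; first exact: cvg_cst.
  by apply: cvgM; [exact: cvg_cst|exact: cvg_id].
exact: continuous_cos.
Qed.

(** The free phase [a] covers cosine and sine together, and it absorbs the remaining coordinates
    when the cube is integrated one coordinate at a time. *)
Lemma integral_cos_itv01 (R : realType) (a : R) (k : int) :
  (\int[@lebesgue_measure R]_(t in `[0%R, 1%R]) (cos (a + 2 * pi * (k%:~R * t)))%:E =
   (cos a * (k == 0)%:R)%:E)%E.
Proof.
have [->|k0] := eqVneq k 0.
  under eq_integral do rewrite mul0r mulr0 addr0.
  rewrite integral_cst//= lebesgue_measure_itv /= lte01 oppr0 adde0 mule1.
  by rewrite mulr1.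
rewrite mulr0; pose w : R := 2 * pi * k%:~R.
have w0 : w != 0.
  by rewrite /w !mulf_eq0 !negb_or pnatr_eq0 intr_eq0 k0 (gt_eqF (pi_gt0 R)).
pose F t : R := w^-1 * sin (a + w * t).
have dF (t : R) : is_derive t 1 F (cos (a + w * t)).
  rewrite (_ : F = w^-1 \*: (@sin R \o (fun t => a + w * t))); last by apply/funext.
  apply: is_derive_eq.
  by rewrite /GRing.scale /=; field.
under eq_integral do rewrite mulrA -/w.
have cf : continuous (fun t : R => cos (a + w * t)).
  exact: continuous_cos_affine.
rewrite (@continuous_FTC2 _ _ F)//.
- rewrite /F mulr1 mulr0 addr0 -EFinB -mulrBr.
  (* As [w] is an integer multiple of [2 * pi], the primitive takes the same value at both ends. *)
  rewrite (_ : sin (a + w) = sin a) ?subrr ?mulr0//.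
  exact: sinD2piz.
- exact: continuous_subspaceT.
- split.
  + by move=> t _; have [] := dF t.
  + apply: cvg_at_right_filter; apply: differentiable_continuous.
    by apply/derivable1_diffP; have [] := dF 0.
  + apply: cvg_at_left_filter; apply: differentiable_continuous.
    by apply/derivable1_diffP; have [] := dF 1.
- by move=> t _; rewrite derive1E; have [_ ->] := dF t.
Qed.

Section unit_cube_theory.
Variable R : realType.
Local Notation T := (measurableTypeR R).

Lemma measurable_unit_cube n : measurable (@unit_cube R n).
Proof.
rewrite (_ : @unit_cube R n = \big[setI/setT]_(i < n) ((fun t : n.-tuple T => tnth t i) @^-1` `[0, 1])).
  apply: bigsetI_measurable => i _; rewrite -[X in measurable X]setTI.
  by apply: measurable_tnth => //; exact: measurable_itv.
rewrite -bigcap_seq; apply/seteqP; split => t /= h i.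
  by move=> _; rewrite /= in_itv/=; exact: h.
by have := h i; rewrite /= in_itv /= mem_index_enum; exact.
Qed.

Lemma preimage_unit_cubeS n :
  @tuple_of_pair R n @^-1` @unit_cube R n.+1 = `[0, 1] `*` @unit_cube R n.
Proof.
apply/seteqP; split => [[x t] /= h|[x t] /= [hx ht] i].
  split; first by rewrite /= in_itv/=; have := h ord0.
  by move=> i; have := h (lift ord0 i); rewrite (tnth_nth 0) /= -tnth_nth.
case: (unliftP ord0 i) => [j|] ->; last by rewrite in_itv in hx.
by rewrite (tnth_nth 0) /= -tnth_nth; exact: ht.
Qed.

Lemma lebesgue_measure_itv01 :
  lebesgue_measure (`[0%R, 1%R] : set T) = 1%E.
Proof. by rewrite lebesgue_measure_itv /= lte01 oppr0 adde0. Qed.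

Lemma lebesgue_unit_cube n : lebesgue_tuple R n (@unit_cube R n) = 1%E.
Proof.
elim: n => [|n IHn] /=.
  by rewrite diracE mem_set// => -[].
rewrite /lebesgue_tuple_step /pushforward preimage_unit_cubeS.
rewrite product_measure1E//; last exact: measurable_unit_cube.
by rewrite [X in (_ * X)%E]IHn mule1; exact: lebesgue_measure_itv01.
Qed.

Lemma measurable_cos_phase n (a : R) (k : 'I_n -> int) :
  measurable_fun [set: n.-tuple T]
    (fun t => cos (a + 2 * pi * \sum_(i < n) (k i)%:~R * tnth t i)).
Proof.
apply: measurableT_comp.
  by apply: continuous_measurable_fun; exact: continuous_cos.
apply: measurable_funD => //; apply: measurable_funM => //.
apply: measurable_sum => i; apply: measurable_funM => //.
exact: measurable_tnth.
Qed.

Lemma integrable_unit_cube n (f : n.-tuple T -> R) (M : R) :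
  measurable_fun setT f -> (forall t, `|f t| <= M) ->
  (lebesgue_tuple R n).-integrable (@unit_cube R n) (EFin \o f).
Proof.
move=> mf fM; apply: measurable_bounded_integrable.
- exact: measurable_unit_cube.
- by rewrite [ltLHS]lebesgue_unit_cube ltry.
- exact: measurable_funTS.
- exists M; split; first by rewrite num_real.
  by move=> y My t _ /=; apply: le_trans (fM t) (ltW My).
Qed.

(** Orthogonality of the characters of the torus. Fubini separates the first coordinate, whose
    contribution joins the phase [a] in the induction hypothesis; the one-dimensional integral then
    finishes. *)
Lemma integral_cos_unit_cube n (a : R) (k : 'I_n -> int) :
  (\int[lebesgue_tuple R n]_(t in @unit_cube R n)
     (cos (a + 2 * pi * \sum_(i < n) (k i)%:~R * tnth t i))%:E =
   (cos a * \prod_(i < n) (k i == 0)%:R)%:E)%E.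
Proof.
elim: n a k => [|n IHn] a k.
  rewrite integral_dirac; [|exact: measurable_unit_cube|]; last first.
    apply/measurable_EFinP; apply: measurable_funTS.
    exact: measurable_cos_phase.
  by rewrite diracE mem_set ?mul1e ?big_ord0 ?mulr0 ?addr0 ?mulr1// => -[].
pose f (t : n.+1.-tuple T) : R := cos (a + 2 * pi * \sum_(i < n.+1) (k i)%:~R * tnth t i).
have mf : measurable_fun setT f by exact: measurable_cos_phase.
pose D : set (T * n.-tuple T) := `[0%R, 1%R] `*` @unit_cube R n.
have mD : measurable D by apply: measurableX => //; exact: measurable_unit_cube.
pose g p : \bar R := (f (tuple_of_pair p))%:E.
pose m1 := @lebesgue_measure R; pose m2 := lebesgue_tuple R n.
have ig : (m1 \x m2)%E.-integrable D g.
  apply: (@measurable_bounded_integrable _ _ _ _ (f \o @tuple_of_pair R n)) => //.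
  - rewrite [ltLHS]product_measure1E//; last exact: measurable_unit_cube.
    rewrite [X in (_ * X)%E]lebesgue_unit_cube mule1.
    by rewrite [ltLHS]lebesgue_measure_itv01 ltry.
  - apply: measurable_funTS; apply: measurableT_comp => //.
    exact: measurable_tuple_of_pair.
  - exists 1; split; first by rewrite num_real.
    move=> y y1 p _ /=; apply: le_trans (ltW y1).
    by rewrite ler_norml cos_geN1 cos_le1.
transitivity (\int[m1 \x m2]_(p in D) g p)%E.
  rewrite /D -preimage_unit_cubeS.
  rewrite -[RHS](@integral_pushforward _ _ _ _ _ _ _ _ _ (EFin \o f)).
  - by [].
  - exact: measurable_tuple_of_pair.
  - exact/measurable_EFinP.
  - by rewrite preimage_unit_cubeS.
  - exact: measurable_unit_cube.
(* Fubini is applied on the whole space to the integrand extended by 0 off the cube. *)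
rewrite integral_mkcond -integral12_prod_meas1; last first.
  by apply/(integrable_mkcond _ mD).
transitivity (\int[m1]_(x in `[0%R, 1%R])
    (cos (a + 2 * pi * ((k ord0)%:~R * x)) * \prod_(i < n) (k (lift ord0 i) == 0)%:R)%:E)%E.
  rewrite [RHS]integral_mkcond; apply: eq_integral => x _.
  rewrite /fubini_F /patch.
  case: ifPn => xI.
    rewrite -IHn [RHS]integral_mkcond; apply: eq_integral => y _.
    rewrite /patch /D in_setX xI /=; case: ifPn => // _.
    rewrite /g /f big_ord_recl /= mulrDr addrA.
    by congr (cos (_ + _ * _))%:E; apply: eq_bigr => i _; rewrite (tnth_nth 0) /= -tnth_nth.
  by apply: integral0_eq => y _; rewrite /D in_setX (negbTE xI).
rewrite big_ord_recl.
under eq_integral do rewrite EFinM.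
rewrite integralZr//; last first.
  apply: continuous_compact_integrable; first exact: segment_compact.
  apply: continuous_subspaceT; under eq_fun do rewrite mulrA.
  exact: continuous_cos_affine.
by rewrite integral_cos_itv01 -EFinM mulrA.
Qed.

End unit_cube_theory.

(** * Poisson point processes *)

Lemma eseries_EFin_cvg (R : realType) (u : nat -> R) (l : R) :
  (\sum_(k < n) u k) @[n --> \oo] --> l -> (\sum_(0 <= k <oo) (u k)%:E = l%:E)%E.
Proof.
move=> ul; apply: cvg_lim => //.
under eq_fun do rewrite sumEFin big_mkord.
by apply: cvg_EFin; [exact: nearW|exact: ul].
Qed.

Section poisson_processes.
Variables (R : realType) (d : measure_display) (Omega : measurableType d).
Variable P : probability Omega R.
Local Open Scope ereal_scope.

(** Independence over [I] only concerns finite subfamilies; a duplicate-free list [s] is indexed by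
    its positions, which gives a finite disjoint family as in the definition of the process. *)
Lemma independent_point_counts (S : countType) (nu : set S -> \bar R)
    (L : Omega -> S -> nat) (I : eqType) (A : I -> set S) :
  poisson_point_process P L nu ->
  (forall i j l, A i l -> A j l -> i = j) ->
  independent P (fun i => point_count R L (A i)).
Proof.
move=> [_ indep] A_disj s B s_uniq mB.
pose t := in_tuple s; pose n := size s.
have tA : trivIset setT (fun i : 'I_n => A (tnth t i)).
  move=> i j _ _ [l [Ai Aj]]; apply/val_inj/eqP.
  have := A_disj _ _ _ Ai Aj; rewrite (tnth_nth (tnth t i)) [RHS](tnth_nth (tnth t i)) => /eqP.
  by rewrite nth_uniq.
have := indep n _ tA (enum 'I_n) (fun i => B (tnth t i)) (enum_uniq _) (fun i => mB _).
rewrite big_enum /= => PB; rewrite [RHS]big_tnth -PB; congr (P _).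
apply/seteqP; split => w h i /=.
  by move=> _; apply: (h (tnth t i)); rewrite /= mem_tnth.
by move=> /(tnthP t)[j ->]; apply: (h j); rewrite /= mem_enum.
Qed.

Let poisson_pmf_series (m : R) :
  (\sum_(k < n) (expR (- m) * m ^+ k / k`!%:R) @[n --> \oo] --> (1 : R))%R.
Proof.
have h : ((fun n => \sum_(k < n) m ^+ k / k`!%:R) @ \oo --> expR m)%R.
  rewrite (_ : (fun n => _) = series (exp_coeff m)).
    exact: is_cvg_series_exp_coeff.
  by apply/funext => n; rewrite /series /exp_coeff /= big_mkord.
rewrite -[X in _ --> X](@mulVf _ (expR m)) ?expR_eq0// -expRN.
under eq_fun do under eq_bigr do rewrite -mulrA.
under eq_fun do rewrite -mulr_sumr.
exact: cvgMr.
Qed.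

(** [poisson_rv] only prescribes the masses at the natural numbers. They add up to 1, so the other
    values are negligible and the integral is the series of [k] times the mass at [k]. *)
Lemma poisson_expectation (X : Omega -> \bar R) (m : R) :
  (forall w, 0 <= X w) -> poisson_rv P X m%:E -> \int[P]_w X w = m%:E.
Proof.
move=> X_ge0 [mX [m_ge0 pX]].
pose A (k : nat) := [set w | X w = k%:R%:E].
have mA k : measurable (A k).
  rewrite (_ : A k = X @^-1` [set k%:R%:E])//.
  by rewrite -[X in measurable X]setTI; apply: mX.
have tA : trivIset setT A.
  move=> i j _ _ [w []]; rewrite /A /= => -> /eqP.
  by rewrite eqe eqr_nat => /eqP.
have mUA : measurable (\bigcup_k A k) by exact: bigcup_measurable.
have PUA : P (\bigcup_k A k) = 1.
  rewrite measure_bigcup//.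
  rewrite (eq_eseriesl (Q := xpredT)); last by move=> k; rewrite in_setT.
  rewrite (eq_eseriesr (fun k _ => pX k)).
  exact: eseries_EFin_cvg (poisson_pmf_series m).
have PC : P (~` \bigcup_k A k) = 0 by rewrite probability_setC// PUA subee.
rewrite (@ge0_negligible_integral _ _ _ P setT (~` \bigcup_k A k))//; last exact: measurableC.
rewrite setTD setCK ge0_integral_bigcup//; last exact: measurable_funTS.
transitivity (\sum_(0 <= k <oo) (k%:R * (expR (- m) * m ^+ k / k`!%:R))%:E).
  apply: eq_eseriesr => k _; rewrite EFinM -pX.
  rewrite (eq_integral (fun=> k%:R%:E)); last by move=> w; rewrite inE.
  by rewrite integral_cst.
apply: eseries_EFin_cvg.
(* The term [k = 0] vanishes, and [k.+1] times the mass at [k.+1] is [m] times the mass at [k]. *)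
rewrite -[X in _ --> X]mulr1 -cvg_shiftS /=.
have E n : (\sum_(k < n.+1) k%:R * (expR (- m) * m ^+ k / k`!%:R) =
    m * \sum_(k < n) (expR (- m) * m ^+ k / k`!%:R))%R.
  rewrite big_ord_recl mul0r add0r mulr_sumr; apply: eq_bigr => k _.
  rewrite lift0 factS natrM exprS; field.
  by rewrite [(1 + _)%R]nat1r !pnatr_eq0 -lt0n fact_gt0.
by under eq_fun do rewrite E; exact: cvgMr.
Qed.

End poisson_processes.

(** * Fourier coefficients of the logarithm of the determinant *)

Lemma ln_prod (R : realType) (I : finType) (f : I -> R) :
  (forall i, 0 < f i) -> ln (\prod_i f i) = \sum_i ln (f i).
Proof.
move=> f0; apply: proj2 (_ : 0 < \prod_i f i /\ _).
elim/big_rec2: _ => [|i x y _ [x0 <-]]; first by rewrite ln1.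
by split; [rewrite mulr_gt0|rewrite lnM ?posrE].
Qed.

Section net_traversals_theory.
Variables (R : realType) (V : finType).

(** Net traversals read on arbitrary vertex sequences, so that they apply to the tuples in the trace
    expansion; on [rep l] this unfolds to [net_traversals]. *)
Definition net_steps (e : V * V) (s : seq V) : int :=
  (count_mem e (steps s))%:Z - (count_mem (e.2, e.1) (steps s))%:Z.

Lemma net_steps_rot e i s : net_steps e (rot i s) = net_steps e s.
Proof.
rewrite /net_steps steps_rot.
by congr (_%:Z - _%:Z); apply/permP; rewrite perm_rot.
Qed.

Variables (r : nat) (eo : 'I_r -> V * V).

Lemma sum_eta_steps i s :
  \sum_(e <- steps s) Defs.eta R eo i e.1 e.2 = (net_steps (eo i) s)%:~R.
Proof.
rewrite /Defs.eta sumrB rmorphB /=; congr (_ - _).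
  rewrite -pmulrn -sum1_count natr_sum [RHS]big_mkcond /=; apply: eq_bigr => -[x y] _ /=.
  by rewrite -pair_eqE /=; case: (_ && _).
rewrite -pmulrn -sum1_count natr_sum [RHS]big_mkcond /=; apply: eq_bigr => -[x y] _ /=.
by rewrite -pair_eqE /= andbC; case: (_ && _).
Qed.

End net_traversals_theory.

Section twisted_loops.
Variables (R : realType) (V : finType) (E : rel V).
Variables (C : V -> V -> R) (kappa : V -> R).
Hypothesis connE : connected_graph E.
Hypothesis C_sym : forall x y, C x y = C y x.
Hypothesis C_gt0 : forall x y, E x y -> 0 < C x y.
Hypothesis C_eq0 : forall x y, ~~ E x y -> C x y = 0.
Hypothesis kappa_ge0 : forall x, 0 <= kappa x.
Hypothesis kappa_neq0 : exists x, kappa x != 0.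
Variables (r : nat) (eo : 'I_r -> V * V).

Local Open Scope complex_scope.
Local Notation w := (walk_weight C kappa).
Local Notation T := (measurableTypeR R).
Local Notation net i s := (net_steps (eo i) s).

Let C_ge0 x y : 0 <= C x y.
Proof. by case: (boolP (E x y)) => [/C_gt0/ltW|/C_eq0 ->]. Qed.

(** The phases multiply along a closed path, and their exponents add up to the net traversals paired
    with [theta]. *)
Lemma twisted_trace (theta : r.-tuple R) n :
  \tr (twisted_transition C kappa eo theta ^+ n.+1) =
  \sum_(t : n.+1.-tuple V) (w t)%:C *
    expi (2 * pi * \sum_(i < r) (net i t)%:~R * tnth theta i).
Proof.
rewrite (@mxtrace_pow_loops _ _ (fun x y => (transition C kappa x y)%:C *
    expi (2 * pi * \sum_(i < r) tnth theta i * Defs.eta R eo i x y))).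
apply: eq_bigr => t _; rewrite big_split /= -rmorph_prod /=; congr (_ * _).
rewrite -(big_morph _ (@expiD R) (@expi0 R)) -mulr_sumr exchange_big /=.
congr (expi (_ * _)); apply: eq_bigr => i _.
by rewrite -mulr_sumr sum_eta_steps mulrC.
Qed.

Let twisted_spectrum' (theta : r.-tuple R) :
  let M := twisted_transition C kappa eo theta in
  exists d : 'I_#|V| -> R, [/\ forall i, `|d i| < 1,
    \det (1%:M - M) = (\prod_i (1 - d i))%:C &
    forall n, \tr (M ^+ n) = (\sum_i d i ^+ n)%:C].
Proof.
pose phi x y := 2 * pi * \sum_(i < r) tnth theta i * Defs.eta R eo i x y.
have phi_anti x y : phi y x = - phi x y.
  rewrite /phi -mulrN -sumrN; congr (_ * _); apply: eq_bigr => i _.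
  by rewrite -mulrN; congr (_ * _); rewrite /Defs.eta opprB.
exact: (twisted_spectrum connE C_sym C_gt0 C_ge0 kappa_ge0 kappa_neq0 phi_anti).
Qed.

Let Re_sum (I : finType) (f : I -> R[i]) :
  complex.Re (\sum_i f i) = \sum_i complex.Re (f i).
Proof. by apply: (big_morph (@complex.Re R)) => // -[? ?] [? ?]. Qed.

Let Im_sum (I : finType) (f : I -> R[i]) :
  complex.Im (\sum_i f i) = \sum_i complex.Im (f i).
Proof. by apply: (big_morph (@complex.Im R)) => // -[? ?] [? ?]. Qed.

Let ReZ (a b : R) : complex.Re (a%:C * expi b) = a * cos b.
Proof. by rewrite /= mul0r subr0. Qed.

Let ImZ (a b : R) : complex.Im (a%:C * expi b) = a * sin b.
Proof. by rewrite /= mul0r addr0. Qed.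

(** The real part of the trace of the power [n.+1] of the twisted matrix, expanded over closed
    walks. *)
Definition cos_trace n (theta : r.-tuple R) : R :=
  \sum_(t : n.+1.-tuple V)
    w t * cos (2 * pi * \sum_(i < r) (net i t)%:~R * tnth theta i).

(** The sum is the imaginary part of a trace that equals a sum of powers of real eigenvalues. *)
Lemma sin_trace_eq0 n (theta : r.-tuple R) :
  \sum_(t : n.+1.-tuple V)
    w t * sin (2 * pi * \sum_(i < r) (net i t)%:~R * tnth theta i) = 0.
Proof.
have [d [_ _ /(_ n.+1)]] := twisted_spectrum' theta.
rewrite twisted_trace => /(congr1 (@complex.Im R)); rewrite Im_sum.
by under eq_bigr do rewrite ImZ.
Qed.

(** The determinant is the product of the positive numbers [1 - d i], so its logarithm splits and
    the logarithmic series is summed eigenvalue by eigenvalue. *)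
Lemma twisted_logdet (theta : r.-tuple R) :
  (\sum_(k < n) cos_trace k theta / k.+1%:R) @[n --> \oo] -->
  - ln (complex.Re (\det (1%:M - twisted_transition C kappa eo theta))).
Proof.
have [d [d_lt1 -> tr_d]] := twisted_spectrum' theta.
rewrite /= ln_prod => [|i]; last first.
  by rewrite subr_gt0; apply: le_lt_trans (d_lt1 i); exact: ler_norm.
rewrite -sumrN.
have cE k : cos_trace k theta = \sum_i d i ^+ k.+1.
  have := tr_d k.+1; rewrite twisted_trace => /(congr1 (@complex.Re R)).
  by rewrite Re_sum => e; apply: etrans e; apply: eq_bigr => t _; rewrite ReZ.
rewrite (_ : (fun n => _) = (fun n => \sum_i \sum_(k < n) d i ^+ k.+1 / k.+1%:R)); last first.
  apply/funext => n; rewrite exchange_big; apply: eq_bigr => k _ /=.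
  by rewrite cE mulr_suml.
apply: cvg_big => [|i _]; first exact: add_continuous.
exact: cvg_ln_series.
Qed.

(** By the addition formula the left side splits into a cosine and a sine trace, and the latter
    vanishes; this factors the Fourier character out of the trace. *)
Lemma twisted_cos_trace k (a : R) (h : 'I_r -> int) (theta : r.-tuple R) :
  \sum_(t : k.+1.-tuple V)
    w t * cos (a + 2 * pi * \sum_(i < r) (net i t - h i)%:~R * tnth theta i) =
  cos_trace k theta * cos (a - 2 * pi * \sum_(i < r) (h i)%:~R * tnth theta i).
Proof.
set H := 2 * pi * \sum_(i < r) (h i)%:~R * _.
transitivity (\sum_(t : k.+1.-tuple V)
    (w t * cos (2 * pi * \sum_(i < r) (net i t)%:~R * tnth theta i) * cos (a - H) -
     w t * sin (2 * pi * \sum_(i < r) (net i t)%:~R * tnth theta i) * sin (a - H))).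
  apply: eq_bigr => t _.
  set N := 2 * pi * \sum_(i < r) (net i t)%:~R * _.
  rewrite (_ : a + _ = N + (a - H)); first by rewrite (cosD N) mulrBr !mulrA.
  under eq_bigr do rewrite intrB mulrBl; rewrite sumrB.
  by rewrite /N /H; ring.
by rewrite sumrB -!mulr_suml sin_trace_eq0 mul0r subr0.
Qed.

(** The loop measure of the loops of length [k.+1] with net traversals [h], computed on based
    loops. *)
Definition loop_mass (h : 'I_r -> int) (k : nat) : R := k.+1%:R^-1 *
  \sum_(t : k.+1.-tuple V | [forall i, net i t == h i]) w t.

(** Dominated convergence for the logarithmic series multiplied by a shifted character. The phase
    [a] will be 0 for the real part of the Fourier coefficient and [- (pi / 2)] for the imaginary
    part. *)
Lemma cvg_loop_mass (a : R) (h : 'I_r -> int) :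
  (cos a * \sum_(k < n) loop_mass h k) @[n --> \oo] -->
  - Rintegral (lebesgue_tuple R r) (@unit_cube R r) (fun theta =>
      ln (complex.Re (\det (1%:M - twisted_transition C kappa eo theta))) *
      cos (a - 2 * pi * \sum_(i < r) (h i)%:~R * tnth theta i)).
Proof.
set lam := lebesgue_tuple R r.
pose f (theta : r.-tuple T) : R :=
  ln (complex.Re (\det (1%:M - twisted_transition C kappa eo theta))) *
  cos (a - 2 * pi * \sum_(i < r) (h i)%:~R * tnth theta i).
pose G k (t : k.+1.-tuple V) (theta : r.-tuple T) : R :=
  cos (a + 2 * pi * \sum_(i < r) (net i t - h i)%:~R * tnth theta i).
pose Fk k (theta : r.-tuple T) : R := 
  k.+1%:R^-1 * \sum_(t : k.+1.-tuple V) w t * G k t theta.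
pose F n (theta : r.-tuple T) : R := \sum_(k < n) Fk k theta.
have mG k t : measurable_fun setT (G k t) by exact: measurable_cos_phase.
have mFk k : measurable_fun setT (Fk k).
  apply: measurable_funM => //; apply: measurable_sum => t.
  by apply: measurable_funM.
have mF n : measurable_fun setT (F n) by apply: measurable_sum => k.
have cvgF theta : F n theta @[n --> \oo] --> - f theta.
  rewrite /f -mulNr (_ : (fun n => _) = fun n => (\sum_(k < n) cos_trace k theta / k.+1%:R) *
      cos (a - 2 * pi * \sum_(i < r) (h i)%:~R * tnth theta i)); last first.
    apply/funext => n; rewrite /F mulr_suml; apply: eq_bigr => k _.
    by rewrite /Fk /G twisted_cos_trace mulrA [_^-1 * _]mulrC.
  by apply: cvgMl; exact: twisted_logdet.
(* At angle 0 all phases are 1, so the terms [v k] are nonnegative and dominate those at every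
   angle. Their series converges by [twisted_logdet], which supplies the constant bound [L]. *)
pose z : r.-tuple R := [tuple of nseq r 0].
pose v k := cos_trace k z / k.+1%:R.
have vE k : v k = k.+1%:R^-1 * \sum_(t : k.+1.-tuple V) w t.
  rewrite /v mulrC; congr (_ * _); apply: eq_bigr => t _.
  by rewrite big1 ?mulr0 ?cos0 ?mulr1// => i _; rewrite tnth_nseq mulr0.
have v_ge0 k : 0 <= v k.
  rewrite vE mulr_ge0// sumr_ge0// => t _; exact: walk_weight_ge0.
pose Sv : R^nat := fun n => \sum_(k < n) v k.
have [L vL] : exists L : R, forall n, Sv n <= L.
  exists (limn Sv); apply: nondecreasing_cvgn_le.
    by apply/nondecreasing_seqP => m; rewrite /Sv big_ord_recr /= lerDl.
  have : Sv @ \oo --> - ln (complex.Re (\det (1%:M - twisted_transition C kappa eo z))).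
    exact: twisted_logdet.
  exact: cvgP.
have GF k t theta : `|G k t theta| <= 1 by rewrite ler_norml cos_geN1 cos_le1.
have FL n theta : `|F n theta| <= L.
  apply: le_trans (vL n); apply: le_trans (ler_norm_sum _ _ _) _.
  apply: ler_sum => k _; rewrite vE normrM ger0_norm ?invr_ge0//.
  rewrite ler_wpM2l ?invr_ge0//; apply: le_trans (ler_norm_sum _ _ _) _.
  apply: ler_sum => t _; rewrite normrM ger0_norm ?walk_weight_ge0//.
  by rewrite ler_piMr ?walk_weight_ge0.
have mD : measurable (@unit_cube R r) by exact: measurable_unit_cube.
have mf : measurable_fun (@unit_cube R r) (fun theta => - f theta).
  apply: (measurable_fun_cvg (h := F)) => [n|theta _]; last exact: cvgF.
  exact: measurable_funTS.
have iL : lam.-integrable (@unit_cube R r) (EFin \o cst L).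
  by apply: (@integrable_unit_cube _ _ _ `|L|).
have mFE n : measurable_fun (@unit_cube R r) (EFin \o F n).
  by apply/measurable_EFinP; exact: measurable_funTS.
have mfE : measurable_fun (@unit_cube R r) (EFin \o (fun theta => - f theta)).
  exact/measurable_EFinP.
have cvg_ae : {ae lam, forall theta, unit_cube theta ->
    ((EFin \o F n) theta @[n --> \oo] --> (EFin \o (fun theta => - f theta)) theta)}.
  by apply: aeW => theta _; apply: cvg_EFin; [exact: nearW|exact: cvgF].
have bound_ae : {ae lam, forall theta n, unit_cube theta ->
    (`|(EFin \o F n) theta| <= (EFin \o cst L) theta)%E}.
  by apply: aeW => theta n _; rewrite /= lee_fin.
have [intf _ cvg_int] := dominated_convergence mD mFE mfE cvg_ae iL bound_ae.
(* Integrating each walk separately, orthogonality keeps exactly those with net traversals [h], with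
   the factor [cos a]. *)
have intF n : (\int[lam]_(theta in @unit_cube R r) (F n theta)%:E)%E =
    (cos a * \sum_(k < n) loop_mass h k)%:E.
  have iG k t : lam.-integrable (@unit_cube R r) (EFin \o G k t).
    exact: (@integrable_unit_cube _ _ _ 1).
  under eq_integral => theta _.
    rewrite /F /Fk -sumEFin.
    under eq_bigr => k _.
      rewrite mulr_sumr -sumEFin; under eq_bigr => t _ do rewrite mulrA EFinM.
      over.
    over.
  rewrite integral_sum//; last first.
    move=> k; apply: integrable_sum => // t _.
    by apply: integrableZl => //; exact: iG.
  rewrite mulr_sumr -sumEFin; apply: eq_bigr => k _.
  rewrite integral_sum//; last first.
    by move=> t; apply: integrableZl => //; exact: iG.
  rewrite /loop_mass mulrCA [in RHS]big_mkcond /= !mulr_sumr -sumEFin; apply: eq_bigr => t _.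
  rewrite integralZl//; last exact: iG.
  rewrite integral_cos_unit_cube -EFinM; congr EFin.
  have -> : \prod_(i < r) (net i t - h i == 0)%:R =
      ([forall i, net i t == h i])%:R :> R.
    case: (boolP [forall i, net i t == h i]) => [/forallP hi|/forallPn[i hi]].
      by rewrite big1// => i _; rewrite subr_eq0 hi.
    by rewrite (bigD1 i)//= subr_eq0 (negbTE hi) mul0r.
  by case: ifP => _; rewrite ?mulr1n ?mulr0n; ring.
have -> : - Rintegral lam (@unit_cube R r) f =
    Rintegral lam (@unit_cube R r) (fun theta => - f theta).
  apply/eqP; rewrite eqr_oppLR; apply/eqP.
  rewrite -mulN1r -RintegralZl//; apply: eq_Rintegral => theta _.
  by rewrite mulN1r opprK.
move: cvg_int; rewrite -(fineK (integrable_fin_num mD intf)) => /fine_cvg /=.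
by under eq_fun do rewrite /= intF /=; exact.
Qed.

Lemma loop_measure_net (h : 'I_r -> int) (l : R) :
  (\sum_(k < n) loop_mass h k) @[n --> \oo] --> l ->
  loop_measure C kappa [set l : loop E | forall i, net_traversals (eo i) l = h i] =
  l%:E.
Proof.
move=> ml.
rewrite (_ : [set _ | _] =
    [set l : loop E | [forall i, net i (rep l) == h i]]); last first.
  apply/seteqP; split => x /=.
    by move=> H; apply/forallP => i; apply/eqP; exact: H.
  by move=> /forallP H i; apply/eqP; exact: H.
rewrite (@loop_measure_walks _ _ _ _ _ C_ge0 C_eq0 kappa_ge0
  (fun s => [forall i, net i s == h i])).
  exact: eseries_EFin_cvg.
by move=> i s; apply: eq_forallb => j; rewrite net_steps_rot.
Qed.

End twisted_loops.

(** * Poisson law and Fourier formula for the loop counts *)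

Local Open Scope complex_scope.

Theorem theorem2 (R : realType) (V : finType) (E T : rel V)
  (C : V -> V -> R) (kappa : V -> R)
  (eo : 'I_(cycle_rank E) -> V * V)
  (alpha : R)
  (d : measure_display) (Omega : measurableType d) (P : probability Omega R)
  (L : Omega -> loop E -> nat)
  (graphE : simple_graph E)
  (connE : connected_graph E)
  (C_sym : forall x y, C x y = C y x)
  (C_gt0 : forall x y, E x y -> 0 < C x y)
  (C_eq0 : forall x y, ~~ E x y -> C x y = 0)
  (kappa_ge0 : forall x, 0 <= kappa x)
  (kappa_neq0 : exists x, kappa x != 0)
  (treeT : spanning_tree E T)
  (eoP : chord_orientation T eo)
  (alpha_gt0 : 0 < alpha)
  (PPP : poisson_point_process P L
           (fun A => (alpha%:E * loop_measure C kappa A)%E)) :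
  let r := cycle_rank E in
  let mu := loop_measure C kappa in
  let loops_with (h : r.-tuple int) : set (loop E) :=
    [set l | forall i, net_traversals (eo i) l = tnth h i] in
  let N (h : r.-tuple int) := point_count R L (loops_with h) in
  independent P N /\
  forall h : r.-tuple int,
    [/\ poisson_rv P (N h) (alpha%:E * mu (loops_with h))%E,
        (\int[P]_w N h w = alpha%:E * mu (loops_with h))%E,
        mu (loops_with h) \is a fin_num &
        (alpha * fine (mu (loops_with h)))%:C =
          - alpha%:C *
          Cintegral (lebesgue_tuple R r) (@unit_cube R r)
            (fun theta =>
               (ln (complex.Re (\det (1%:M - twisted_transition C kappa eo theta))))%:C *
               \prod_(i < r) expi (- (2 * pi * (tnth h i)%:~R * tnth theta i)))].
Proof.
move=> r mu loops_with N.
split.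
  (* A loop determines its vector of net traversals, so the sets [loops_with h] are pairwise
     disjoint. *)
  apply: independent_point_counts PPP _ => h h' l hl h'l.
  by apply: eq_from_tnth => i; rewrite -hl -h'l.
move=> h.
pose D theta := ln (complex.Re (\det (1%:M - twisted_transition C kappa eo theta))).
pose H (theta : r.-tuple R) := 2 * pi * \sum_(i < r) (tnth h i)%:~R * tnth theta i.
pose lam := lebesgue_tuple R r.
pose I := - Rintegral lam (@unit_cube R r) (fun theta => D theta * cos (0 - H theta)).
have cvg_mass a : (cos a * \sum_(k < n) loop_mass C kappa eo (tnth h) k) @[n --> \oo] -->
    - Rintegral lam (@unit_cube R r) (fun theta => D theta * cos (a - H theta)).
  exact: (cvg_loop_mass connE).
have muE : mu (loops_with h) = I%:E.
  apply: (loop_measure_net C_gt0 C_eq0 kappa_ge0).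
  have := cvg_mass 0; rewrite cos0.
  by under eq_fun do rewrite mul1r.
have int0 : Rintegral lam (@unit_cube R r) (fun theta => D theta * sin (- H theta)) = 0.
  (* With this phase the factor [cos a] is 0 while the cosine under the integral becomes a sine, so
     the imaginary part of the Fourier integral is 0. *)
  have := cvg_mass (- (pi / 2)); rewrite cosN cos_pihalf.
  under eq_fun do rewrite mul0r.
  move=> /(cvg_lim (@Rhausdorff R)); rewrite lim_cst// => /esym/eqP.
  rewrite oppr_eq0 => /eqP <-.
  by apply: eq_Rintegral => theta _; rewrite [X in cos X]addrC cosBpihalf.
have [PPPN _] := PPP.
have PN : poisson_rv P (N h) (alpha%:E * mu (loops_with h))%E by exact: PPPN.
split=> //.
- move: PN; rewrite muE -EFinM; apply: poisson_expectation => w.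
  by apply: esum_ge0 => l _; rewrite lee_fin.
- by rewrite muE.
(* The product of exponentials is a single one of argument [- H theta]; the real part is written
   with [0 - H theta] to match [I]. *)
have intE theta : (D theta)%:C *
    \prod_(i < r) expi (- (2 * pi * (tnth h i)%:~R * tnth theta i)) =
    (D theta * cos (0 - H theta)) +i* (D theta * sin (- H theta)).
  rewrite -(big_morph _ (@expiD R) (@expi0 R)) sumrN sub0r.
  have -> : \sum_(i < r) 2 * pi * (tnth h i)%:~R * tnth theta i = H theta.
    by rewrite /H mulr_sumr; apply: eq_bigr => i _; rewrite mulrA.
  by rewrite /expi; simpc.
have -> : Cintegral lam (@unit_cube R r) (fun theta => (D theta)%:C *
    \prod_(i < r) expi (- (2 * pi * (tnth h i)%:~R * tnth theta i))) = (- I)%:C.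
  rewrite /Cintegral; congr (_ +i* _).
    by rewrite /I opprK; apply: eq_Rintegral => theta _; rewrite intE.
  by rewrite -int0; apply: eq_Rintegral => theta _; rewrite intE.
by rewrite muE /= -rmorphN -rmorphM /= mulrNN.
Qed.
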